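(* Let $c_0\in\mathbb R$ and $f(y)=y+y^2/2$. Let $k\in\mathbb Z$, $k\ge0$, $\theta\in[0,1]$, $u_0\in C^{k,\theta}(\mathbb R)$, and let $u=u(x,t)\in C^\infty((-T,T):C^{k,\theta}(\mathbb R))$ be the corresponding local solution of $$\partial_t u+(1-\partial_x^2)^{-1}(\partial_x u+u\,\partial_x u)=0,\qquad u(x,0)=u_0(x),\quad x\in\mathbb R.$$ Suppose that for some $t_0\in(-T,T)$ and some $a,b\in\mathbb R$ with $a<b$ one has $u(a,t_0)=u(b,t_0)=c_0$. If one of the following two conditions holds: (1) $f(u(x,t_0))\le f(c_0)$ for $x\in[a,b]$, $\;f(u(x,t_0))\ge f(c_0)$ for $x\notin[a,b]$, and $\partial_tu(b,t_0)\ge\partial_tu(a,t_0)$; (2) $f(u(x,t_0))\le f(c_0)$ for $x\notin[a,b]$, $\;f(u(x,t_0))\ge f(c_0)$ for $x\in[a,b]$, and $\partial_tu(a,t_0)\ge\partial_tu(b,t_0)$; then $u(x,t)\equiv c_0$.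
   Context: For $k\in\mathbb Z$, $k\ge0$, and $\theta\in[0,1]$, $C^{k,\theta}(\mathbb R)$ is the space of $g:\mathbb R\to\mathbb R$ of class $C^k$ with $g,g',\dots,g^{(k)}$ bounded and with finite norm $$\|g\|_{C^{k,\theta}}=\sum_{j=0}^k\|g^{(j)}\|_\infty+\sup_{h\ne0}\Big\|\frac{g^{(k)}(\cdot+h)-g^{(k)}(\cdot)}{|h|^\theta}\Big\|_\infty .$$ The nonlocal term is understood as $(1-\partial_x^2)^{-1}(\partial_xu+u\partial_xu)=\partial_x(1-\partial_x^2)^{-1}\big(u+\tfrac{u^2}{2}\big)$, where $\partial_x(1-\partial_x^2)^{-1}g=K*g$ with $K(x)=-\tfrac12\,\mathrm{sgn}(x)e^{-|x|}$. Local well-posedness: for every $u_0\in C^{k,\theta}(\mathbb R)$ there exist $T=T(\|u_0\|_{C^{k,\theta}})>0$ and a unique solution $u\in C^\infty((-T,T):C^{k,\theta}(\mathbb R))$ of the initial value problem; the solution $u$ and the time $T$ in the claim are these. The conclusion means $u(x,t)=c_0$ for all $(x,t)\in\mathbb R\times(-T,T)$. *)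

(* Defs.v *)
From HB Require Import structures.
From mathcomp Require Import all_boot all_order all_algebra.
From mathcomp Require Import all_classical all_reals all_analysis.

Set Implicit Arguments.
Unset Strict Implicit.
Unset Printing Implicit Defensive.

Import Order.TTheory GRing.Theory Num.Theory.
Import numFieldNormedType.Exports.

Local Open Scope ring_scope.
Local Open Scope classical_set_scope.

(* In ring_scope these notations would denote formal derivatives of
   polynomials. *)
Local Notation "g ^` ()" := (derive1 g) : ring_scope.
Local Notation "g ^` ( j )" := (derive1n j g) : ring_scope.

Section sup_norm.
Context {R : realType}.
Implicit Types g : R -> R.

(* The real-valued [sup] is 0 on unbounded sets: [sup_norm] is only meant for
   bounded functions. *)
Definition sup_norm g : R := sup [set `|g x| | x in [set: R]].

Lemma bounded_funP g : bounded_fun g <-> exists M, forall x, `|g x| <= M.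
Proof.
have ? : ProperFilter (globally [set: R]).
  by apply: (@globally_properfilter _ _ 0).
rewrite /= ex_bound; split=> -[M gM]; exists M; last by move=> x _; exact: gM.
by move=> x; exact: gM.
Qed.

Lemma sup_norm_ub g x : bounded_fun g -> `|g x| <= sup_norm g.
Proof.
move=> /bounded_funP[M gM]; apply: ub_le_sup; last by exists x.
by exists M => _ [y _ <-]; exact: gM.
Qed.

Lemma sup_norm_le g M : (forall x, `|g x| <= M) -> sup_norm g <= M.
Proof.
move=> gM; apply: ge_sup; first by exists `|g 0|, 0.
by move=> _ [x _ <-]; exact: gM.
Qed.

Lemma sup_norm_ge0 g : 0 <= sup_norm g.
Proof.
rewrite /sup_norm; set A := (X in sup X).
have [hA|/sup_out -> //] := pselect (has_sup A).
apply: (le_trans (normr_ge0 (g 0))); apply: ub_le_sup; first by case: hA.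
by exists 0.
Qed.

Lemma bounded_funDZ a g1 g2 :
  bounded_fun g1 -> bounded_fun g2 -> bounded_fun (a *: g1 + g2).
Proof.
move=> b1 b2; apply/bounded_funP; exists (`|a| * sup_norm g1 + sup_norm g2).
move=> x; apply: (le_trans (ler_normD _ _)).
by rewrite normrM lerD ?ler_wpM2l ?sup_norm_ub.
Qed.

Lemma sup_normDZ a g1 g2 : bounded_fun g1 -> bounded_fun g2 ->
  sup_norm (a *: g1 + g2) <= `|a| * sup_norm g1 + sup_norm g2.
Proof.
move=> b1 b2; apply: sup_norm_le => x; apply: (le_trans (ler_normD _ _)).
by rewrite normrM lerD ?ler_wpM2l ?sup_norm_ub.
Qed.

End sup_norm.

Section holder_space.
Context {R : realType}.
Variables (k : nat) (theta : R).
Implicit Types g : R -> R.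

Definition holder_quotient g (h x : R) : R :=
  (g^`(k) (x + h) - g^`(k) x) / `|h| `^ theta.

Definition holder_quotients g : set R :=
  [set sup_norm (holder_quotient g h) | h in [set h | h != 0]].

Definition holder_norm g : R :=
  \sum_(j < k.+1) sup_norm g^`(j) + sup (holder_quotients g).

Definition is_Ck g : Prop :=
  (forall j x, (j < k)%N -> derivable g^`(j) x 1) /\ continuous g^`(k).

Definition is_holder g : Prop :=
  [/\ is_Ck g,
      forall j, (j <= k)%N -> bounded_fun g^`(j) &
      has_ubound (holder_quotients g)].

Definition holder_pred : {pred R -> R} := mem [set g | is_holder g].

Record holder_space := HolderSpace {
  holder_val :> R -> R ;
  _ : holder_val \in holder_pred }.

HB.instance Definition _ := [isSub for holder_val].
HB.instance Definition _ := [Choice of holder_space by <:].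

Lemma holderP (g : holder_space) : is_holder g.
Proof. by have := valP g; rewrite inE. Qed.

Lemma derive1n_DZ a g1 g2 j : (j <= k)%N -> is_Ck g1 -> is_Ck g2 ->
  (a *: g1 + g2)^`(j) = a *: g1^`(j) + g2^`(j).
Proof.
move=> + [d1 _] [d2 _]; elim: j => [//|j ih] jk.
rewrite !derive1nS ih; last exact: ltnW.
apply/funext => x; rewrite derive1E deriveD.
- rewrite deriveZ; last exact: d1.
  by rewrite addrfctE scalrfctE !derive1E.
- by apply: derivableZ; exact: d1.
- exact: d2.
Qed.

Lemma is_CkDZ a g1 g2 : is_Ck g1 -> is_Ck g2 -> is_Ck (a *: g1 + g2).
Proof.
move=> c1 c2; split=> [j x jk|].
  rewrite derive1n_DZ//; last exact: ltnW.
  by apply: derivableD; [apply: derivableZ; apply: c1.1|apply: c2.1].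
rewrite derive1n_DZ// => x.
by apply: cvgD; [apply: cvgZr; apply: c1.2|apply: c2.2].
Qed.

Lemma bounded_holder_quotient g h : is_holder g ->
  bounded_fun (holder_quotient g h).
Proof.
move=> [_ /(_ _ (leqnn k)) gb _]; apply/bounded_funP.
exists ((sup_norm g^`(k) + sup_norm g^`(k)) * `|(`|h| `^ theta)^-1|) => x.
rewrite normrM ler_wpM2r//; apply: (le_trans (ler_normB _ _)).
by rewrite lerD ?sup_norm_ub.
Qed.

Lemma holder_quotientDZ a g1 g2 h : is_Ck g1 -> is_Ck g2 ->
  holder_quotient (a *: g1 + g2) h =
  a *: holder_quotient g1 h + holder_quotient g2 h.
Proof.
move=> c1 c2; apply/funext => x.
rewrite /holder_quotient derive1n_DZ// !addrfctE !scalrfctE /GRing.scale/=.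
by rewrite mulrA -mulrDl mulrBr opprD addrACA.
Qed.

Lemma holder_quotients_neq0 g : holder_quotients g !=set0.
Proof. by exists (sup_norm (holder_quotient g 1)), 1 => //=; rewrite oner_neq0. Qed.

Lemma holder_quotients_ubDZ a g1 g2 : is_holder g1 -> is_holder g2 ->
  ubound (holder_quotients (a *: g1 + g2))
    (`|a| * sup (holder_quotients g1) + sup (holder_quotients g2)).
Proof.
move=> h1 h2 _ [h h0 <-].
have [[c1 _ u1] [c2 _ u2]] := (h1, h2).
rewrite holder_quotientDZ//.
apply: (le_trans (sup_normDZ _ _ _)); try exact: bounded_holder_quotient.
by rewrite lerD ?ler_wpM2l//; apply: ub_le_sup => //; exists h.
Qed.

Lemma derive1n0E j : (0 : R -> R)^`(j) = 0.
Proof.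
elim: j => // j ih; rewrite derive1nS ih; apply/funext => x.
by rewrite derive1E -[0]/(cst 0) derive_cst.
Qed.

Lemma sup_norm_holder_quotient0 h : sup_norm (holder_quotient 0 h) <= 0.
Proof.
apply: sup_norm_le => x.
by rewrite /holder_quotient derive1n0E subrr mul0r normr0.
Qed.

Lemma holder_submod_closed : submod_closed holder_pred.
Proof.
split; last first.
  move=> a g1 g2; rewrite !inE /= => h1 h2.
  have [[c1 b1 _] [c2 b2 _]] := (h1, h2); split.
  - exact: is_CkDZ.
  - by move=> j jk; rewrite derive1n_DZ//; apply: bounded_funDZ; auto.
  - eexists; exact: (holder_quotients_ubDZ h1 h2).
rewrite inE /=; split.
- split=> [j x _|]; rewrite derive1n0E; last exact: cst_continuous.
  exact: derivable_cst.
- move=> j _; rewrite derive1n0E; apply/bounded_funP.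
  by exists 0 => x; rewrite normr0.
- by exists 0 => _ [h _ <-]; exact: sup_norm_holder_quotient0.
Qed.

HB.instance Definition _ :=
  GRing.isSubmodClosed.Build R (R -> R) holder_pred holder_submod_closed.
HB.instance Definition _ := [SubChoice_isSubLmodule of holder_space by <:].

Lemma holder_normDZ a g1 g2 : is_holder g1 -> is_holder g2 ->
  holder_norm (a *: g1 + g2) <= `|a| * holder_norm g1 + holder_norm g2.
Proof.
move=> h1 h2; have [[c1 b1 _] [c2 b2 _]] := (h1, h2).
rewrite /holder_norm mulrDr addrACA lerD//; last first.
  by apply: ge_sup; [exact: holder_quotients_neq0|exact: holder_quotients_ubDZ].
rewrite mulr_sumr -big_split/= ler_sum// => j _.
have jk : (j <= k)%N by rewrite -ltnS.
by rewrite derive1n_DZ// sup_normDZ//; auto.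
Qed.

Lemma sup_holder_quotients_ge0 g : is_holder g -> 0 <= sup (holder_quotients g).
Proof.
move=> [_ _ u]; apply: (le_trans (sup_norm_ge0 (holder_quotient g 1))).
by apply: ub_le_sup => //; exists 1 => //=; rewrite oner_neq0.
Qed.

Lemma sup_norm_le_holder g j : is_holder g -> (j <= k)%N ->
  sup_norm g^`(j) <= holder_norm g.
Proof.
move=> hg jk; rewrite /holder_norm (bigD1 (Ordinal (jk : (j < k.+1)%N)))//=.
rewrite -addrA lerDl addr_ge0 ?sup_holder_quotients_ge0//.
by apply: sumr_ge0 => i _; exact: sup_norm_ge0.
Qed.

Lemma norm_le_holder (g : holder_space) x : `|g x| <= holder_norm g.
Proof.
have hg := holderP g; apply: le_trans (sup_norm_le_holder hg (leq0n k)).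
by apply: sup_norm_ub; case: hg => _ /(_ _ (leq0n k)).
Qed.

Lemma holder_norm_ge0 (g : holder_space) : 0 <= holder_norm g.
Proof. exact: le_trans (norm_le_holder g 0). Qed.

Lemma holder_ler_normD (g1 g2 : holder_space) :
  holder_norm (g1 + g2 : holder_space) <= holder_norm g1 + holder_norm g2.
Proof.
have := holder_normDZ 1 (holderP g1) (holderP g2).
by rewrite scale1r normr1 mul1r.
Qed.

Lemma holder_norm0 : holder_norm 0 = 0.
Proof.
apply/eqP; rewrite eq_le (holder_norm_ge0 0) andbT -[leRHS]addr0 lerD//.
  apply: sumr_le0 => j _; apply: sup_norm_le => x.
  by rewrite derive1n0E normr0.
apply: ge_sup; first exact: holder_quotients_neq0.
by move=> _ [h _ <-]; exact: sup_norm_holder_quotient0.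
Qed.

Lemma holder_normrZ (a : R) (g : holder_space) :
  holder_norm (a *: g : holder_space) = `|a| * holder_norm g.
Proof.
have leZ b (g1 : holder_space) :
    holder_norm (b *: g1 : holder_space) <= `|b| * holder_norm g1.
  have := holder_normDZ b (holderP g1) (holderP 0).
  by rewrite holder_norm0 !addr0.
have [->|a0] := eqVneq a 0.
  by rewrite scale0r holder_norm0 normr0 mul0r.
apply/eqP; rewrite eq_le leZ/= -ler_pdivlMl ?normr_gt0// -normfV.
by rewrite -[X in holder_norm (holder_val X) <= _](scalerK a0) leZ.
Qed.

Lemma holder_normr0_eq0 (g : holder_space) : holder_norm g = 0 -> g = 0.
Proof.
move=> g0; apply/val_inj/funext => x; apply/eqP; rewrite -normr_le0 -g0.
exact: norm_le_holder.
Qed.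

HB.instance Definition _ := Lmodule_isNormed.Build R holder_space
  holder_ler_normD holder_normrZ holder_normr0_eq0.

Lemma holder_normE (g : holder_space) : `|g| = holder_norm g.
Proof. by []. Qed.

Lemma derive1_holder_val (u : R -> holder_space) t x : derivable u t 1 ->
  (fun s => u s x)^`() t = u^`() t x.
Proof.
move=> ut; apply: cvg_lim => //.
have ev (v w : holder_space) : `|v x - w x| <= `|v - w|.
  exact: (norm_le_holder (v - w)).
have /cvgrPdist_lt cu : h^-1 *: (u (h + t) - u t) @[h --> 0^'] --> u^`() t.
  move: ut; rewrite /derivable /= => ut.
  suff -> : (fun h : R => h^-1 *: (u (h + t) - u t)) =
     (fun h : R => h^-1 *: (u (h *: 1 + t) - u t)) by rewrite derive1E; exact: ut.
  by apply/funext => h; rewrite [h *: 1]mulr1.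
apply/cvgrPdist_lt => e e0; near=> h.
have := ev (u^`() t) (h^-1 *: (u (h + t) - u t)).
move=> /le_lt_trans; apply; near: h; exact: cu.
Unshelve. all: by end_near. Qed.

End holder_space.

Arguments holder_space {R} k theta.
Notation "''C^(' k , theta )" := (holder_space k theta) : type_scope.

Section bbm.
Local Open Scope ring_scope.
Context {R : realType}.

Definition bbm_flux (y : R) : R := y + y ^+ 2 / 2.

(* Convolution kernel of d/dx (1 - d^2/dx^2)^-1. *)
Definition bbm_kernel (x : R) : R := - (1 / 2) * (Num.sg x * expR (- `|x|)).

Definition convolution (f g : R -> R) (x : R) : R :=
  \int[lebesgue_measure]_y (f (x - y) * g y).

(* u : (-T, T) -> V is of class C^oo in the norm of V; the values of u outside
   the open interval are irrelevant. *)
Definition smooth_on (V : normedModType R) (T : R) (u : R -> V) : Prop :=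
  forall n t, t \in `]- T, T[ -> derivable u^`(n) t 1.

(* The time derivative u^`() is taken in C^{k,theta}; it agrees with the
   pointwise one by derive1_holder_val. *)
Definition bbm_solution k (theta : R) (T : R) (u0 : 'C^(k, theta))
    (u : R -> 'C^(k, theta)) : Prop :=
  [/\ smooth_on T u,
      u 0 = u0 &
      forall x t, t \in `]- T, T[ ->
        u^`() t x + convolution bbm_kernel (bbm_flux \o u t) x = 0].

End bbm.

(* Main.v *)
(* Write h = f(u(.,t0)) - f(c0).  The kernel K has zero mean, so the equation
   gives u_t(b,t0) - u_t(a,t0) = - \int (K(b-y) - K(a-y)) h(y) dy.  The weight
   K(b-y) - K(a-y) is negative on (a,b) and positive outside [a,b], so the
   hypotheses on h and on u_t force h = 0; by connectedness u(.,t0) = c0.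
   Since K * (.) is bounded in the sup norm and f is locally Lipschitz, a
   Gronwall argument propagates u = c0 from t0 to the whole time interval. *)
Require Import Defs.
From HB Require Import structures.
From mathcomp Require Import all_boot all_order all_algebra.
From mathcomp Require Import all_classical all_reals all_analysis.
From mathcomp Require Import measurable_realfun.
From mathcomp Require Import ring lra.

Set Implicit Arguments.
Unset Strict Implicit.
Unset Printing Implicit Defensive.

Import Order.TTheory GRing.Theory Num.Theory.
Import numFieldNormedType.Exports.

Local Open Scope ring_scope.

(** * Integrability and zero mean of the translated kernel *)

Section kernel.
Context {R : realType}.
Local Notation mu := (@lebesgue_measure R).
Implicit Types x y : R.

Lemma is_derive_expRB (x y : R) :
  is_derive y 1 (fun z => - expR (x - z)) (expR (x - y)).
Proof.
apply: is_derive_eq.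
by rewrite /GRing.scale /=; ring.
Qed.

Lemma integral_expR_right (x : R) :
  (\int[mu]_(y in `[x, +oo[) (expR (x - y))%:E = 1)%E.
Proof.
have cF : continuous (fun z => - expR (x - z)).
  by move=> y; apply/differentiable_continuous/derivable1_diffP;
    case: (is_derive_expRB x y).
rewrite (@ge0_continuous_FTC2y R _ (fun y => - expR (x - y)) x 0).
- by rewrite subrr expR0 EFinN oppeK add0e.
- by move=> y _; exact: expR_ge0.
- apply: continuous_subspaceT => y.
  apply: continuous_comp; last exact: continuous_expR.
  by apply: cvgB; [exact: cvg_cst|exact: cvg_id].
- have -> : (fun y => - expR (x - y)) = (fun y => - expR x * expR (- y)).
    by apply/funext => y; rewrite expRD mulNr.
  rewrite -(mulr0 (- expR x)); apply: cvgMr; exact: cvgr_expR.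
- by move=> y _; case: (is_derive_expRB x y).
- by apply: cvg_at_right_filter; exact: cF.
- by move=> y _; rewrite derive1E; have [_ ->] := is_derive_expRB x y.
Qed.

(** Reflecting the variable gives the right tail based at [- x]. *)
Lemma integral_expR_left (x : R) :
  (\int[mu]_(y in `]-oo, x[) (expR (y - x))%:E = 1)%E.
Proof.
have c : continuous (fun y => expR (y - x)).
  move=> y; apply: continuous_comp; last exact: continuous_expR.
  by apply: cvgD; [exact: cvg_id|exact: cvg_cst].
rewrite integral_itv_bndo_bndc; last first.
  apply/measurable_EFinP; apply: measurable_funTS.
  exact: continuous_measurable_fun.
rewrite -[in `]-oo, x]](opprK x) ge0_integration_by_substitutionNy.
- rewrite -[RHS](integral_expR_right (- x)).
  by apply: eq_integral => y _ /=; rewrite addrC.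
- exact: continuous_subspaceT.
- by move=> y _; exact: expR_ge0.
Qed.

Lemma continuous_expR_dist (x : R) : continuous (fun y => expR (- `|x - y|)).
Proof.
move=> y; apply: continuous_comp; last exact: continuous_expR.
apply: cvgN; apply: cvg_norm.
by apply: cvgB; [exact: cvg_cst|exact: cvg_id].
Qed.

Lemma integral_expR_dist (x : R) :
  (\int[mu]_y (expR (- `|x - y|))%:E = 2)%E.
Proof.
rewrite -(setUv `]-oo, x[) ge0_integral_setU//=.
- rewrite setCitvl -[2%:E]/((1 + 1)%:E) EFinD; congr (_ + _)%E.
  + rewrite -(integral_expR_left x); apply: eq_integral => y.
    rewrite inE/= in_itv/= => yx; rewrite ger0_norm ?opprB//.
    by rewrite subr_ge0 ltW.
  + rewrite -(integral_expR_right x); apply: eq_integral => y.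
    rewrite inE/= in_itv/= andbT => xy; rewrite ler0_norm ?opprK//.
    by rewrite subr_le0.
- exact: measurableC.
- rewrite setUv; apply/measurable_EFinP; apply: continuous_measurable_fun.
  exact: continuous_expR_dist.
- exact/disj_setPCl.
Qed.

Lemma integrable_expR_dist (x : R) :
  mu.-integrable setT (EFin \o (fun y => expR (- `|x - y|))).
Proof.
apply/integrableP; split.
  apply/measurable_EFinP; apply: continuous_measurable_fun.
  exact: continuous_expR_dist.
under eq_integral do rewrite /= ger0_norm ?expR_ge0//.
by rewrite integral_expR_dist ltry.
Qed.

Lemma measurable_bbm_kernel (x : R) :
  measurable_fun [set: R] (fun y => bbm_kernel (x - y)).
Proof.
apply: measurable_funM => //; apply: measurable_funM.
  apply: (measurableT_comp (f := @Num.sg R)).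
    apply: nondecreasing_measurable => // a b ab.
    by case: (sgrP a); case: (sgrP b) => //; lra.
  exact: measurable_funB.
apply: continuous_measurable_fun; exact: continuous_expR_dist.
Qed.

(** The majorant is continuous even where the kernel jumps, and its mass is 2; it serves both for
    integrability and for the sup bound on convolutions. *)
Lemma bbm_kernel_le x : `|bbm_kernel x| <= expR (- `|x|).
Proof.
rewrite /bbm_kernel normrM normrN normrM normr_sg (ger0_norm (expR_ge0 _)).
rewrite (@ger0_norm _ (1 / 2))// mulrA ler_piMl ?expR_ge0//.
by case: (x != 0) => /=; lra.
Qed.

Lemma integrable_bbm_kernel (x : R) :
  mu.-integrable setT (EFin \o (fun y => bbm_kernel (x - y))).
Proof.
apply: (le_integrable _ _ _ (integrable_expR_dist x)) => //.
  by apply/measurable_EFinP; exact: measurable_bbm_kernel.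
move=> y _ /=; rewrite lee_fin (ger0_norm (expR_ge0 _)).
exact: bbm_kernel_le.
Qed.

(** The kernel is odd: the half-lines left and right of [x] contribute -1/2 and 1/2. *)
Lemma Rintegral_bbm_kernel (x : R) : \int[mu]_y (bbm_kernel (x - y)) = 0.
Proof.
have E := integrable_expR_dist x.
have eL y : y \in `]-oo, x[%classic ->
    bbm_kernel (x - y) = - (1 / 2) * expR (y - x).
  rewrite inE/= in_itv/= -subr_gt0 => yx.
  by rewrite /bbm_kernel (gtr0_sg yx) (gtr0_norm yx) !mul1r opprB.
have eR y : y \in `]x, +oo[%classic ->
    bbm_kernel (x - y) = (1 / 2) * expR (x - y).
  rewrite inE/= in_itv/= andbT -subr_lt0 => xy.
  by rewrite /bbm_kernel (ltr0_sg xy) (ltr0_norm xy) opprK mulN1r mulrNN.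
have iS (A : set R) : measurable A ->
    mu.-integrable A (EFin \o (fun y => bbm_kernel (x - y))).
  by move=> mA; apply: integrableS (integrable_bbm_kernel x).
rewrite -(setUv `]-oo, x[) Rintegral_setU//=; last 3 first.
- exact: measurableC.
- by rewrite setUv; exact: integrable_bbm_kernel.
- exact/disj_setPCl.
(* The point [x] is dropped from the right half-line: the kernel is 0 there, so the formula of [eR]
   fails at it. *)
rewrite setCitvl -Rintegral_itv_obnd_cbnd; last exact: iS.
transitivity (\int[mu]_(y in `]-oo, x[) (- (1 / 2) * expR (y - x)) +
              \int[mu]_(y in `]x, +oo[) (1 / 2 * expR (x - y))).
  by congr (_ + _); apply: eq_Rintegral => y; [exact: eL|exact: eR].
have iE (A : set R) (g : R -> R) : measurable A ->
    {in A, g =1 fun y => expR (- `|x - y|)} -> mu.-integrable A (EFin \o g).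
  move=> mA gA.
  have : mu.-integrable A (EFin \o (fun y => expR (- `|x - y|))).
    by apply: integrableS E.
  by apply: eq_integrable => // y yA /=; rewrite gA.
have iL : mu.-integrable `]-oo, x[ (EFin \o (fun y => expR (y - x))).
  apply: iE => // y; rewrite inE/= in_itv/= -subr_gt0 => yx.
  by rewrite gtr0_norm// opprB.
have iR : mu.-integrable `]x, +oo[ (EFin \o (fun y => expR (x - y))).
  apply: iE => // y; rewrite inE/= in_itv/= andbT -subr_lt0 => xy.
  by rewrite ltr0_norm// opprK.
rewrite !RintegralZl// Rintegral_itv_obnd_cbnd//.
rewrite /Rintegral integral_expR_left integral_expR_right /=.
by rewrite !mulr1 addNr.
Qed.

End kernel.

(** * Convolution with the kernel, and continuous nonnegative functions of null integral *)

Section convolution_bbm_kernel.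
Context {R : realType}.
Local Notation mu := (@lebesgue_measure R).
Implicit Types (x y : R) (g h : R -> R).

Lemma Rintegral_expR_dist x : \int[mu]_y expR (- `|x - y|) = 2.
Proof. by rewrite /Rintegral integral_expR_dist. Qed.

Lemma integrable_expR_distM x g B : measurable_fun [set: R] g ->
  (forall y, `|g y| <= B) ->
  mu.-integrable setT (EFin \o (fun y => expR (- `|x - y|) * g y)).
Proof.
move=> mg gB.
have : mu.-integrable setT (EFin \o (fun y => B * expR (- `|x - y|))).
  have := integrableZl measurableT B (integrable_expR_dist x).
  by apply: eq_integrable.
apply: le_integrable => //.
- apply/measurable_EFinP; apply: measurable_funM => //.
  by apply: continuous_measurable_fun; exact: continuous_expR_dist.
- move=> y _; rewrite /= lee_fin !normrM mulrC ler_wpM2r//.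
  exact: (le_trans (gB y) (ler_norm _)).
Qed.

Lemma integrable_bbm_kernelM x g B : measurable_fun [set: R] g ->
  (forall y, `|g y| <= B) ->
  mu.-integrable setT (EFin \o (fun y => bbm_kernel (x - y) * g y)).
Proof.
move=> mg gB.
have := integrable_expR_distM x mg gB; apply: le_integrable => //.
- apply/measurable_EFinP; apply: measurable_funM => //.
  exact: measurable_bbm_kernel.
- move=> y _; rewrite /= lee_fin normrM [leRHS]normrM ler_wpM2r//.
  by rewrite (ger0_norm (expR_ge0 _)); exact: bbm_kernel_le.
Qed.

(** By zero mean, constants convolve to 0; the flux may thus be replaced by its deviation from
    [bbm_flux c0]. *)
Lemma convolution_bbm_kernelBc g (c : R) x B : measurable_fun [set: R] g ->
  (forall y, `|g y| <= B) ->
  convolution bbm_kernel (fun y => g y - c) x = convolution bbm_kernel g x.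
Proof.
move=> mg gB; rewrite /convolution.
transitivity (\int[mu]_y (bbm_kernel (x - y) * g y - c * bbm_kernel (x - y))).
  by apply: eq_Rintegral => y _; rewrite mulrBr (mulrC c).
rewrite RintegralB//; last 2 first.
- exact: integrable_bbm_kernelM gB.
- have := integrableZl measurableT c (integrable_bbm_kernel x).
  by apply: eq_integrable => // y _.
rewrite RintegralZl//; last exact: integrable_bbm_kernel.
by rewrite Rintegral_bbm_kernel mulr0 subr0.
Qed.

Lemma convolution_bbm_kernelN g x B : measurable_fun [set: R] g ->
  (forall y, `|g y| <= B) ->
  convolution bbm_kernel (fun y => - g y) x = - convolution bbm_kernel g x.
Proof.
move=> mg gB; rewrite -mulN1r -RintegralZl//.
  by apply: eq_Rintegral => y _; rewrite mulrN mulN1r.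
exact: integrable_bbm_kernelM gB.
Qed.

(** The constant 2 is the mass of the majorant from [bbm_kernel_le]. *)
Lemma convolution_bbm_kernel_le g x B : measurable_fun [set: R] g ->
  (forall y, `|g y| <= B) -> `|convolution bbm_kernel g x| <= 2 * B.
Proof.
move=> mg gB.
have ig := integrable_bbm_kernelM x mg gB.
apply: (le_trans (le_normr_Rintegral _ ig)) => //.
rewrite -(Rintegral_expR_dist x) -RintegralZr//; last first.
  exact: integrable_expR_dist.
apply: le_Rintegral => //.
- by have := integrable_abse ig; apply: eq_integrable => // y _.
- have := integrableZr measurableT B (integrable_expR_dist x).
  by apply: eq_integrable => // y _.
- move=> y _; rewrite normrM ler_pM//; exact: bbm_kernel_le.
Qed.

(** If [g x] were positive, [g] would exceed [g x / 2] near [x], and a short interval would already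
    make the integral positive. *)
Lemma continuous_Rintegral_le0 g : continuous g -> (forall y, 0 <= g y) ->
  mu.-integrable setT (EFin \o g) -> \int[mu]_y g y <= 0 -> forall y, g y = 0.
Proof.
move=> cg g0 ig Ig x; apply/eqP; rewrite eq_le g0 andbT leNgt.
apply/negP => gx; move: Ig; apply/negP; rewrite -ltNge.
have gx2 : g x / 2 < g x by lra.
have /nbhs_ballP[e /= e0 eg] : nbhs x [set y | g x / 2 < g y]%classic.
  exact: (cvgr_gt (g x) (cg x) _ gx2).
(* Half the radius keeps this closed interval inside the open ball. *)
pose A : set R := `[x, x + e / 2]%classic.
have mA : measurable A by exact: measurable_itv.
have muA : mu A = (e / 2)%:E.
  apply: (eq_trans (lebesgue_measure_itv _)).
  by rewrite /= lte_fin ifT -?EFinB; [congr (_%:E); lra|lra].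
have iA : mu.-integrable A (EFin \o g) by apply: integrableS ig.
rewrite -(setUv A) Rintegral_setU//=; last 3 first.
- exact: measurableC.
- by rewrite setUv.
- exact/disj_setPCl.
rewrite ltr_wpDr//; first by apply: Rintegral_ge0 => y _.
apply: (@lt_le_trans _ _ (\int[mu]_(y in A) (g x / 2))); last first.
  apply: le_Rintegral => //.
    apply: measurable_bounded_integrable => //.
    - by rewrite [X in (X < _)%E]muA ltry.
    - exact: bounded_cst.
  move=> y; rewrite /A/= in_itv/= => /andP[xy yx].
  apply/ltW/eg; rewrite /ball/= ltr_distlC; apply/andP; split; lra.
rewrite Rintegral_cst//.
have -> : fine (mu A) = e / 2 by exact: (congr1 fine muA).
by rewrite mulr_gt0//; lra.
Qed.

End convolution_bbm_kernel.

(** * Rigidity at time [t0]: from the order of the two convolutions to a constant profile *)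

Section rigidity.
Context {R : realType}.
Local Notation mu := (@lebesgue_measure R).
Implicit Types (x y a b : R) (h : R -> R).

(* The endpoints a and b are excluded because the kernel jumps there. *)
Lemma bbm_kernelB_ge a b y : a < b -> y < a \/ b < y ->
  (1 - expR (a - b)) / 2 * expR (- `|a - y|) <=
  bbm_kernel (b - y) - bbm_kernel (a - y).
Proof.
move=> ab [ya|yb]; rewrite /bbm_kernel.
(* Left of [a] the two sides are equal. *)
- have yb := lt_trans ya ab.
  rewrite !gtr0_sg ?subr_gt0// !gtr0_norm ?subr_gt0//.
  have -> : expR (- (b - y)) = expR (- (a - y)) * expR (a - b).
    by rewrite -expRD; congr expR; ring.
  by nra.
- have ya := lt_trans ab yb.
  rewrite !ltr0_sg ?subr_lt0// !ltr0_norm ?subr_lt0//.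
  have -> : expR (- - (b - y)) = expR (- - (a - y)) * expR (b - a).
    by rewrite -expRD; congr expR; ring.
  have E1 : expR (a - b) <= 1 by rewrite -expR0 ler_expR; lra.
  have P1 : 1 <= expR (b - a) by rewrite -expR0 ler_expR; lra.
  have PE : expR (b - a) * expR (a - b) = 1.
    by rewrite -expRD -expR0; congr expR; ring.
  (* Right of [b], once exp(a - y) is factored out, the claim is D + 1/D >= 2 with D = exp(b -
     a). *)
  have : 0 <= expR (- - (a - y)) * (expR (b - a) + expR (a - b) - 2).
    by rewrite mulr_ge0 ?expR_ge0//; nra.
  by nra.
Qed.

(** For [y] between [a] and [b] the two kernel values enter with the same sign, and the one at
    [a - y] suffices. The weight is the one of [bbm_kernelB_ge], so that a single function controls
    both regions. *)
Lemma bbm_kernelB_le a b y : a < y < b ->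
  bbm_kernel (b - y) - bbm_kernel (a - y) <=
  - ((1 - expR (a - b)) / 2 * expR (- `|a - y|)).
Proof.
move=> /andP[ay yb]; rewrite /bbm_kernel.
rewrite (@gtr0_sg _ (b - y)) ?subr_gt0// (@ltr0_sg _ (a - y)) ?subr_lt0//.
have := expR_gt0 (- `|b - y|).
have := mulr_gt0 (expR_gt0 (a - b)) (expR_gt0 (- `|a - y|)).
lra.
Qed.

(** The kernel difference and [h] have the same sign off the endpoints, so their product dominates
    [psi], whose integral is then nonpositive. Unlike the kernel difference, the weight in [psi] is
    continuous and positive everywhere, so [psi] vanishes pointwise and [h] with it. *)
Lemma bbm_conv_rigidity a b h B : a < b -> continuous h ->
  (forall y, `|h y| <= B) -> h a = 0 -> h b = 0 ->
  (forall y, y \in `[a, b] -> h y <= 0) ->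
  (forall y, y \notin `[a, b] -> 0 <= h y) ->
  convolution bbm_kernel h b <= convolution bbm_kernel h a ->
  forall y, h y = 0.
Proof.
move=> ab ch hB ha hb hin hout.
have mh := continuous_measurable_fun ch.
have i1 := integrable_bbm_kernelM b mh hB.
have i2 := integrable_bbm_kernelM a mh hB.
rewrite -subr_le0 -RintegralB//.
pose c := (1 - expR (a - b)) / 2.
have c0 : 0 < c.
  by rewrite /c divr_gt0// subr_gt0 -expR0 ltr_expR subr_lt0.
pose psi y := c * (expR (- `|a - y|) * `|h y|).
have mnh : measurable_fun [set: R] (fun y => `|h y|).
  exact: measurableT_comp.
have nhB y : `| `|h y| | <= B by rewrite normr_id.
have ipsi : mu.-integrable setT (EFin \o psi).
  have := integrableZl measurableT c (integrable_expR_distM a mnh nhB).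
  by apply: eq_integrable => //.
move=> conv0; have psi0 : forall y, psi y = 0.
  apply: continuous_Rintegral_le0 => //.
  - move=> y; apply: cvgM; first exact: cvg_cst.
    apply: cvgM; first exact: continuous_expR_dist.
    by apply: cvg_norm; exact: ch.
  - by move=> y; apply: (mulr_ge0 (ltW c0)); rewrite mulr_ge0 ?expR_ge0.
  - apply: le_trans conv0; apply: le_Rintegral => //.
      have := integrableB measurableT i1 i2.
      by apply: eq_integrable => // y _.
    move=> y _; rewrite /psi -mulrBl mulrA.
    have [->|ya] := eqVneq y a; first by rewrite ha normr0 !mulr0.
    have [->|yb] := eqVneq y b; first by rewrite hb normr0 !mulr0.
    have [yab|yab] := boolP (y \in `[a, b]).
      rewrite (ler0_norm (hin _ yab)) mulrN -mulNr ler_wnM2r ?hin//.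
      apply: bbm_kernelB_le; move: yab; rewrite in_itv/=.
      by rewrite !le_eqVlt eq_sym (negbTE ya) (negbTE yb).
    rewrite (ger0_norm (hout _ yab)) ler_wpM2r ?hout//.
    apply: bbm_kernelB_ge => //; move: yab; rewrite in_itv/= negb_and -!ltNge.
    by move=> /orP[]; [left|right].
move=> y; have /eqP := psi0 y.
rewrite mulf_eq0 (gt_eqF c0)/= mulf_eq0 (gt_eqF (expR_gt0 _))/=.
by rewrite normr_eq0 => /eqP.
Qed.

(** The flux is a parabola with vertex at -1, so [v] takes only the values [c] and [- 2 - c]. If it
    left [c], the intermediate value theorem would produce their midpoint -1, which is neither of
    them unless [c] is -1. *)
Lemma bbm_flux_const_eq (v : R -> R) (c a : R) : continuous v -> v a = c ->
  (forall x, bbm_flux (v x) = bbm_flux c) -> forall x, v x = c.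
Proof.
move=> cv va vf.
have alt x : v x = c \/ v x = - 2 - c.
  have : (v x - c) * (v x + c + 2) = 0.
    by have := vf x; rewrite /bbm_flux; lra.
  move=> /eqP; rewrite mulf_eq0 => /orP[|] /eqP H; [left|right]; lra.
move=> x; have [//|vx] := alt x.
(* For [c] equal to -1 the two candidate values coincide. *)
have [c1|c1] := eqVneq c (- 1); first by rewrite vx c1; lra.
exfalso.
have min_max (z w : R) : Num.min z w <= (z + w) / 2 <= Num.max z w.
  by case: (leP z w) => zw; lra.
have [z vz] : exists z, v z = - 1.
  have key (p q : R) : p <= q -> (v p + v q) / 2 = - 1 -> exists z, v z = - 1.
    move=> pq vpq; have [|z _ vz] := IVT pq (continuous_subspaceT cv) (v := -1).
      by rewrite -vpq; exact: min_max.
    by exists z.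
  case: (leP a x) => [ax|/ltW xa]; first by apply: (key a x) => //; lra.
  by apply: (key x a) => //; lra.
have c1' : c <> - 1 by apply/eqP.
by case: (alt z); rewrite vz => H; apply: c1'; lra.
Qed.

End rigidity.

(** * Gronwall argument in a weighted sup norm *)

Section uniqueness.
Context {R : realType}.
Implicit Types (s t x : R) (v : R -> R -> R).

(** Integrating the derivative bound L B exp(2 L s) from 0 gives at most (B / 2) exp(2 L s): the 2
    in the exponent is what yields the gain of 1/2. *)
Lemma gronwall_contraction v (dv : R -> R -> R) (L B : R) : 0 < L -> 0 <= B ->
  (forall s x, s \in `[0, 1] -> is_derive s 1 (v^~ x) (dv s x)) ->
  (forall s C, s \in `[0, 1] -> (forall x, `|v s x| <= C) ->
    forall x, `|dv s x| <= L * C) ->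
  (forall x, v 0 x = 0) ->
  (forall s x, s \in `[0, 1] -> `|v s x| <= B * expR (2 * L * s)) ->
  forall s x, s \in `[0, 1] -> `|v s x| <= B / 2 * expR (2 * L * s).
Proof.
move=> L0 B0 dvE dvL v0 vB s x s01.
(* Taking [e] to be 1 and -1 bounds the absolute value without differentiating it. *)
have key (e : R) : `|e| = 1 -> e * v s x <= B / 2 * expR (2 * L * s).
  move=> e1.
  pose w t : R := e * v t x - B / 2 * expR (2 * L * t).
  have dw t : t \in `[0, 1] ->
      is_derive t 1 w (e * dv t x - L * (B * expR (2 * L * t))).
    move=> t01; have := dvE t x t01 => ?.
    rewrite /w; apply: is_derive_eq.
    by rewrite /GRing.scale /=; field.
  have s1 : s <= 1 by move: s01; rewrite in_itv/= => /andP[].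
  have s0 : 0 <= s by move: s01; rewrite in_itv/= => /andP[].
  have oc t : t \in `]0, 1[ -> t \in `[0, 1].
    by rewrite !in_itv/= => /andP[? ?]; rewrite !ltW.
  (* The derivative of [w] is nonpositive, and [w 0] is [- (B / 2)]. *)
  have : w s <= w 0.
    apply: (@ler0_derive1_nincr _ w 0 1) => //.
    - by move=> t /oc /dw [].
    - move=> t /oc t01; rewrite derive1E; have [_ ->] := dw t t01.
      rewrite subr_le0; apply: le_trans (dvL t _ t01 (fun y => vB t y t01) x).
      by apply: le_trans (ler_norm _) _; rewrite normrM e1 mul1r.
    - apply: derivable_within_continuous => t /dw [//].
  by rewrite /w v0 !mulr0 expR0; lra.
rewrite ler_norml; have := key 1 (normr1 _); have := key (- 1) (normrN1 _).
by lra.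
Qed.

(** [sup A] is the sup norm of [v] weighted by exp(- 2 L s). It is finite thanks to [M], and the
    contraction bounds it by its own half, so it is 0. *)
Lemma gronwall_eq0 v (dv : R -> R -> R) (L M : R) : 0 < L ->
  (forall s x, s \in `[0, 1] -> is_derive s 1 (v^~ x) (dv s x)) ->
  (forall s C, s \in `[0, 1] -> (forall x, `|v s x| <= C) ->
    forall x, `|dv s x| <= L * C) ->
  (forall x, v 0 x = 0) ->
  (forall s x, s \in `[0, 1] -> `|v s x| <= M) ->
  forall s x, s \in `[0, 1] -> v s x = 0.
Proof.
move=> L0 dvE dvL v0 vM.
pose A : set R :=
  [set z | exists s x, s \in `[0, 1]%R /\ z = `|v s x| / expR (2 * L * s)]%classic.
have ubA : ubound A M.
  move=> _ [s [x [s01 ->]]]; rewrite ler_pdivrMr ?expR_gt0//.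
  apply: (le_trans (vM s x s01)); rewrite ler_peMr//.
    exact: (le_trans (normr_ge0 _) (vM s x s01)).
  rewrite -expR0 ler_expR mulr_ge0 ?mulr_ge0 ?(ltW L0)//.
  by move: s01; rewrite in_itv/= => /andP[].
have supA s x : s \in `[0, 1] -> `|v s x| <= sup A * expR (2 * L * s).
  move=> s01; rewrite -ler_pdivrMr ?expR_gt0//.
  by apply: ub_le_sup; [exists M|exists s, x].
have i01 : (0 : R) \in `[0, 1] by rewrite in_itv/= lexx ler01.
have S0 : 0 <= sup A.
  by have := supA 0 0 i01; rewrite v0 normr0 mulr0 expR0 mulr1.
have SA : sup A <= sup A / 2.
  apply: ge_sup; first by exists (`|v 0 0| / expR (2 * L * 0)), 0, 0.
  move=> _ [s [x [s01 ->]]]; rewrite ler_pdivrMr ?expR_gt0//.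
  exact: gronwall_contraction dvE dvL v0 supA _ _ s01.
have {}S0 : sup A = 0 by lra.
move=> s x /(supA s x); rewrite S0 mul0r normr_le0 => /eqP //.
Qed.

(** * Propagation of a constant state along a solution *)

Context (k : nat) (theta : R).

(** Evaluation at [x] is linear and bounded by the Hölder norm, so norm convergence of the
    difference quotients passes to points. Beyond [derive1_holder_val], this also provides pointwise
    derivability. *)
Lemma is_derive_holder_val (u : R -> 'C^(k, theta)) t x : derivable u t 1 ->
  is_derive t 1 (fun s => u s x) (derive1 u t x).
Proof.
move=> ut; have /cvgrPdist_lt cu := ut.
suff cx : (h^-1 *: (u (h *: 1 + t) x - u t x) @[h --> 0^'] -->
    derive1 u t x)%classic.
  by split; [apply/cvg_ex; eexists; exact: cx|exact: cvg_lim cx].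
apply/cvgrPdist_lt => e e0; near=> h.
rewrite derive1E.
have := norm_le_holder
  ('D_1 u t - h^-1 *: (u (h *: 1 + t) - u t) : 'C^(k, theta)) x.
by move=> /le_lt_trans; apply; near: h; exact: cu.
Unshelve. all: by end_near. Qed.

Lemma continuous_holder (g : 'C^(k, theta)) : continuous g.
Proof.
have [[]] := holderP g; move: (g : R -> R); case: k => [|n] f df cf _ _ //= x.
by apply/differentiable_continuous/derivable1_diffP; exact: (df 0%N).
Qed.

Lemma bbm_flux_le (y N : R) : `|y| <= N -> `|bbm_flux y| <= N + N ^+ 2 / 2.
Proof.
move=> yN; apply: (le_trans (ler_normD _ _)); rewrite lerD// normrM normrX.
by rewrite (@ger0_norm _ 2^-1)//; have := normr_ge0 y; nra.
Qed.

Lemma continuous_bbm_flux : continuous (@bbm_flux R).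
Proof.
move=> y; apply: cvgD; first exact: cvg_id.
by apply: cvgM; [exact: exprn_continuous|exact: cvg_cst].
Qed.

(** The segment from [t0] to [t1] is parametrised by [0, 1]; as [d] may have either sign, one
    Gronwall estimate covers both time directions. *)
Lemma bbm_solution_constant (c0 T : R) (u0 : 'C^(k, theta))
  (u : R -> 'C^(k, theta)) t0 :
  bbm_solution T u0 u -> t0 \in `]- T, T[ -> (forall x, u t0 x = c0) ->
  forall x t, t \in `]- T, T[ -> u t x = c0.
Proof.
move=> [su _ eu] t0T ut0 x t1 t1T.
pose d := t1 - t0.
have pT s : s \in `[0, 1] -> t0 + s * d \in `]- T, T[.
  move: t0T t1T; rewrite !in_itv/= /d => /andP[? ?] /andP[? ?] /andP[? ?].
  by have [?|?] := leP s (1 / 2); apply/andP; split; nra.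
have du s : s \in `[0, 1] -> derivable u (t0 + s * d) 1.
  by move=> /pT; exact: (su 0%N).
pose w s := u (t0 + s * d).
have dw s : s \in `[0, 1] -> {for s, continuous w}.
  move=> s01; apply: (@continuous_comp _ _ _ (fun s => t0 + s * d) u).
    by apply: cvgD; [exact: cvg_cst|apply: cvgM; [exact: cvg_id|exact: cvg_cst]].
  by apply: differentiable_continuous; apply/derivable1_diffP; exact: du.
(* The Hölder norm is continuous along the compact segment, hence bounded on it. *)
have [M uM] : exists M, forall s x, s \in `[0, 1] -> `|w s x| <= M.
  have [||s _ sM] := @EVT_max R (fun s => `|w s|) 0 1.
  - exact: ler01.
  - apply: continuous_in_subspaceT => s /set_mem s01.
    by apply: cvg_norm; exact: dw.
  - exists `|w s| => s1 y s101; apply: le_trans (sM s1 s101).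
    exact: norm_le_holder.
have i01 : (0 : R) \in `[0, 1] by rewrite in_itv/= lexx ler01.
have M0 : 0 <= M by apply: le_trans (normr_ge0 _) (uM 0 0 i01).
(* Here |d| comes from the chain rule, 2 from [convolution_bbm_kernel_le], and the bracket is a
   Lipschitz constant of the flux between [w s] and [c0]; adding 1 keeps [L] positive when [d] is
   0. *)
pose L := `|d| * (2 * (1 + (M + `|c0|) / 2)) + 1.
have L0 : 0 < L by rewrite ltr_wpDl// !mulr_ge0// addr_ge0// divr_ge0// addr_ge0.
suff /eqP : w 1 x - c0 = 0.
  by rewrite /w mul1r /d addrCA subrr addr0 subr_eq0 => /eqP.
apply: (@gronwall_eq0 (fun s y => w s y - c0)
  (fun s y => derive1 u (t0 + s * d) y * d) L (M + `|c0|) L0).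
- move=> s y s01.
  have /= duy := is_derive_holder_val y (du s s01).
  have da : is_derive s 1 (fun s => t0 + s * d) d.
    by apply: is_derive_eq; rewrite /GRing.scale /=; ring.
  have dc := @is_derive1_comp _ (fun t => u t y) (fun s => t0 + s * d) s _ _
    duy da.
  by apply: is_derive_eq; rewrite subr0.
- move=> s C s01 vC y.
  have := eu y _ (pT s s01) => /eqP; rewrite addr_eq0 => /eqP ->.
  have mf : measurable_fun [set: R] (bbm_flux \o w s).
    apply: continuous_measurable_fun => z; apply: continuous_comp.
      exact: continuous_holder.
    exact: continuous_bbm_flux.
  have fM z : `|(bbm_flux \o w s) z| <= M + M ^+ 2 / 2.
    by apply: bbm_flux_le; exact: uM.
  (* Subtracting [bbm_flux c0] makes the convolved function small with [w s - c0]. *)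
  rewrite -(convolution_bbm_kernelBc (bbm_flux c0) _ mf fM).
  rewrite normrM normrN mulrC.
  have C0 : 0 <= C by apply: le_trans (normr_ge0 _) (vC 0).
  have hC z : `|(bbm_flux \o w s) z - bbm_flux c0| <= (1 + (M + `|c0|) / 2) * C.
    have -> : (bbm_flux \o w s) z - bbm_flux c0 =
        (1 + (w s z + c0) / 2) * (w s z - c0) by rewrite /= /bbm_flux; field.
    rewrite normrM ler_pM//.
    apply: (le_trans (ler_normD _ _)); rewrite normr1 lerD// normrM.
    rewrite (@ger0_norm _ 2^-1)// ler_wpM2r//.
    by apply: (le_trans (ler_normD _ _)); rewrite lerD// uM.
  have mh : measurable_fun [set: R] (fun z => (bbm_flux \o w s) z - bbm_flux c0).
    exact: measurable_funB.
  have := convolution_bbm_kernel_le y mh hC => cK.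
  apply: (le_trans (ler_wpM2l (normr_ge0 d) cK)).
  by rewrite /L; nra.
- by move=> y; rewrite /w mul0r addr0 ut0 subrr.
- move=> s y s01; apply: (le_trans (ler_normB _ _)); rewrite lerD//.
  exact: uM.
- by rewrite in_itv/= lexx ler01.
Qed.

End uniqueness.

Theorem theorem1p6 (R : realType) (c0 : R) (k : nat) (theta : R)
  (theta01 : 0 <= theta <= 1) (u0 : 'C^(k, theta))
  (T : R) (T_gt0 : 0 < T) (u : R -> 'C^(k, theta))
  (u_sol : bbm_solution T u0 u)
  (t0 : R) (t0_in : t0 \in `]- T, T[)
  (a b : R) (ab : a < b) (ua : u t0 a = c0) (ub : u t0 b = c0)
  (cond :
    [/\ forall x, x \in `[a, b] -> bbm_flux (u t0 x) <= bbm_flux c0,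
        forall x, x \notin `[a, b] -> bbm_flux c0 <= bbm_flux (u t0 x) &
        derive1 u t0 a <= derive1 u t0 b]
    \/
    [/\ forall x, x \notin `[a, b] -> bbm_flux (u t0 x) <= bbm_flux c0,
        forall x, x \in `[a, b] -> bbm_flux c0 <= bbm_flux (u t0 x) &
        derive1 u t0 b <= derive1 u t0 a]) :
  forall x t, t \in `]- T, T[ -> u t x = c0.
Proof.
have [_ _ eu] := u_sol.
pose F := bbm_flux \o u t0.
have cF : continuous F.
  move=> z; apply: continuous_comp; first exact: continuous_holder.
  exact: continuous_bbm_flux.
have mF := continuous_measurable_fun cF.
have FM z : `|F z| <= `|u t0| + `|u t0| ^+ 2 / 2.
  by apply: bbm_flux_le; exact: norm_le_holder.
pose h y := F y - bbm_flux c0.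
have ch : continuous h by move=> y; apply: cvgB; [exact: cF|exact: cvg_cst].
have mh := continuous_measurable_fun ch.
have hM z : `|h z| <= `|u t0| + `|u t0| ^+ 2 / 2 + `|bbm_flux c0|.
  by apply: (le_trans (ler_normB _ _)); rewrite lerD.
(* The equation at [t0], with the flux recentred so that it vanishes at [a] and [b]. *)
have uE z : derive1 u t0 z = - convolution bbm_kernel h z.
  have /eqP := eu z _ t0_in; rewrite addr_eq0 => /eqP ->.
  by rewrite (convolution_bbm_kernelBc _ _ mF FM).
have ha : h a = 0 by rewrite /h /F /= ua subrr.
have hb : h b = 0 by rewrite /h /F /= ub subrr.
suff h0 y : h y = 0.
  apply: (bbm_solution_constant u_sol t0_in).
  apply: (bbm_flux_const_eq (@continuous_holder _ _ _ (u t0)) ua) => y.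
  by apply/eqP; rewrite -subr_eq0; apply/eqP; exact: h0.
case: cond => -[hin hout]; rewrite !uE lerN2 => hab.
- apply: (bbm_conv_rigidity ab ch hM ha hb) => // z zab; rewrite /h.
    by rewrite subr_le0; exact: hin.
  by rewrite subr_ge0; exact: hout.
(* The second condition is the first one for the opposite of [h]. In this branch [hin] is the
   condition outside the interval and [hout] the one inside. *)
- apply/eqP; rewrite -oppr_eq0; apply/eqP; move: y.
  apply: (bbm_conv_rigidity (h := fun y => - h y)
    (B := `|u t0| + `|u t0| ^+ 2 / 2 + `|bbm_flux c0|) ab).
  + by move=> y; apply: cvgN; exact: ch.
  + by move=> y; rewrite normrN.
  + by rewrite ha oppr0.
  + by rewrite hb oppr0.
  + by move=> y yab; rewrite oppr_le0 subr_ge0; exact: hout.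
  + by move=> y yab; rewrite oppr_ge0 subr_le0; exact: hin.
  + by rewrite !(convolution_bbm_kernelN _ mh hM) lerN2.
Qed.
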